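(* Let $S$ be a $\mathrm{Cu}$-semigroup. Let $y$ and a sequence $(y_n)_{n=1}^{\infty}$ be in $\mathrm{Full}(S)$ with $y_n\leq y_{n+1}\leq y$ for all $n\in\mathbb{Z}_{>0}$. Assume that $\mathcal{F}_y(S)\neq\emptyset$ and $\lim_{n\to\infty}\rho(y,y_n)<\infty$. Then $$\frac{1}{\lim_{n\to\infty}\rho(y_n,y)}\cdot\mathrm{rc}(S,y)\leq\lim_{n\to\infty}\mathrm{rc}(S,y_n)\leq\lim_{n\to\infty}\rho(y,y_n)\cdot\mathrm{rc}(S,y).$$
   Context: For elements $x,y$ of a partially ordered set $P$, $x\ll y$ means: for every increasing sequence $(y_n)$ in $P$ with supremum $y$ there is $n_0$ with $x\leq y_{n_0}$. A $\mathrm{Cu}$-semigroup is a positively ordered abelian monoid $S$ (so $0\leq x$ for all $x$ and the order is compatible with addition) such that: (O1) every increasing sequence in $S$ has a supremum; (O2) every $x\in S$ is the supremum of a sequence $x_0\ll x_1\ll x_2\ll\cdots$; (O3) if $x'\ll x$ and $y'\ll y$ then $x'+y'\ll x+y$; (O4) $\sup_n(x_n+y_n)=\sup_n x_n+\sup_n y_n$ for all increasing sequences $(x_n),(y_n)$. For $x\in S$, $\infty\cdot x=\sup_n n\cdot x$. An element $x$ is full if $\infty\cdot x$ is the largest element of $S$; $\mathrm{Full}(S)$ is the set of full elements. A functional on $S$ is a map $\lambda\colon S\to[0,\infty]$ that is additive, order preserving, satisfies $\lambda(0)=0$, and preserves suprema of increasing sequences. $\mathcal{F}(S)$ is the set of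 functionals on $S$, and $\mathcal{F}_z(S)=\{\lambda\in\mathcal{F}(S):\lambda(z)=1\}$ for $z\in S$. The rank of $x$ is $\widehat{x}\colon\mathcal{F}(S)\to[0,\infty]$, $\widehat{x}(\lambda)=\lambda(x)$; inequalities between ranks are pointwise on $\mathcal{F}(S)$. Rank ratio: $\rho(x,y)=\inf\{r\in(0,\infty):\widehat{x}\leq r\cdot\widehat{y}\}$, with $\rho(x,y)=\infty$ if there is no such $r$. Radius of comparison: for $w\in\mathrm{Full}(S)$ and $r\in(0,\infty)$, $S$ has $r$-comparison relative to $w$ if whenever $x,y\in S$ satisfy $\widehat{x}+r\cdot\widehat{w}\leq\widehat{y}$, then $x\leq y$. $\mathrm{rc}(S,w)$ is the infimum of all $r\in(0,\infty)$ such that $S$ has $r$-comparison relative to $w$, and $\mathrm{rc}(S,w)=\infty$ if there is no such $r$. Convention: $\gamma\cdot\infty=\infty$ for $\gamma\in(0,\infty)$. All limits are of monotone sequences in $[0,\infty]$ and are taken in $[0,\infty]$. *)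

(* Defs.v *)
From HB Require Import structures.
From mathcomp Require Import all_boot all_order all_algebra.
From mathcomp Require Import all_classical all_reals all_analysis.

Set Implicit Arguments.
Unset Strict Implicit.
Unset Printing Implicit Defensive.

Import Order.TTheory GRing.Theory.

Local Open Scope classical_set_scope.
Local Open Scope ring_scope.

(* "Increasing" sequences are the nondecreasing ones, and "[u] has supremum
   [s]" is [supremums (range u) s]. *)
Definition way_below (d : Order.disp_t) (P : porderType d) (x y : P) : Prop :=
  forall u : nat -> P, nondecreasing_seq u -> supremums (range u) y ->
    exists n0 : nat, (x <= u n0)%O.

(* The monoid operation is part of the mixin rather than inherited from
   [GRing.Nmodule]: [Num.POrderedZmodule] is the only join of the order and
   additive hierarchies, and HB rejects a weaker join declared after it. *)
HB.mixin Record isCuSemigroup (d : Order.disp_t) S of Order.POrder d S := {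
  cu_zero : S ;
  cu_add : S -> S -> S ;
  cu_addA : associative cu_add ;
  cu_addC : commutative cu_add ;
  cu_add0 : left_id cu_zero cu_add ;
  cu_ge0 : forall x : S, (cu_zero <= x)%O ;
  cu_leD2r : forall x y z : S, (x <= y)%O -> (cu_add x z <= cu_add y z)%O ;
  cu_O1 : forall u : nat -> S, nondecreasing_seq u ->
    exists s : S, supremums (range u) s ;
  cu_O2 : forall x : S, exists2 u : nat -> S,
    (forall n, way_below (u n) (u n.+1)) & supremums (range u) x ;
  cu_O3 : forall x' x y' y : S, way_below x' x -> way_below y' y ->
    way_below (cu_add x' y') (cu_add x y) ;
  cu_O4 : forall (u v : nat -> S) (s t : S),
    nondecreasing_seq u -> nondecreasing_seq v ->
    supremums (range u) s -> supremums (range v) t ->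
    supremums (range (fun n => cu_add (u n) (v n))) (cu_add s t)
}.

#[short(type="cuSemigroupType")]
HB.structure Definition CuSemigroup (d : Order.disp_t) :=
  { S of Order.POrder d S & isCuSemigroup d S }.

Arguments cu_zero {d s}.

HB.instance Definition _ (d : Order.disp_t) (S : cuSemigroupType d) :=
  Monoid.isComLaw.Build S cu_zero (@cu_add d S) cu_addA cu_addC cu_add0.

Definition cu_nmul (d : Order.disp_t) (S : cuSemigroupType d) (n : nat)
    (x : S) : S :=
  iter n (cu_add x) cu_zero.

(* The default value of [supremum] is never used: the sequence of the
   [cu_nmul n x] is nondecreasing, so it has a supremum by [cu_O1]. *)
Definition infty_mul (d : Order.disp_t) (S : cuSemigroupType d) (x : S) : S :=
  supremum cu_zero (range (fun n : nat => cu_nmul n x)).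

Definition Full (d : Order.disp_t) (S : cuSemigroupType d) : set S :=
  [set x | forall z : S, (z <= infty_mul x)%O].
Arguments Full {d} S.

Local Open Scope ereal_scope.

Record is_functional (R : realType) (d : Order.disp_t) (S : cuSemigroupType d)
    (lam : S -> \bar R) : Prop := {
  functional_ge0 : forall x, 0 <= lam x ;
  functional0 : lam cu_zero = 0 ;
  functionalD : forall x y, lam (cu_add x y) = lam x + lam y ;
  functional_homo : forall x y, (x <= y)%O -> lam x <= lam y ;
  functional_sup : forall (u : nat -> S) (s : S), nondecreasing_seq u ->
    supremums (range u) s -> supremums (range (lam \o u)) (lam s)
}.

Definition functionals (R : realType) (d : Order.disp_t)
    (S : cuSemigroupType d) : set (S -> \bar R) :=
  [set lam | is_functional lam].
Arguments functionals R {d} S.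

Definition functionals_at (R : realType) (d : Order.disp_t)
    (S : cuSemigroupType d) (z : S) : set (S -> \bar R) :=
  functionals R S `&` [set lam | lam z = 1].
Arguments functionals_at R {d S} z.

Definition rank (R : realType) (d : Order.disp_t) (S : cuSemigroupType d)
    (x : S) (lam : S -> \bar R) : \bar R := lam x.

(* The infimum in [\bar R] of the empty set is [+oo]. In [\bar R],
   [r%:E * +oo = +oo] for [0 < r]. *)
Definition rank_ratio (R : realType) (d : Order.disp_t)
    (S : cuSemigroupType d) (x y : S) : \bar R :=
  ereal_inf (EFin @` [set r : R | (0 < r)%R /\
    forall lam, functionals R S lam -> rank x lam <= r%:E * rank y lam]).
Arguments rank_ratio R {d S} x y.

Definition has_comparison (R : realType) (d : Order.disp_t)
    (S : cuSemigroupType d) (r : R) (w : S) : Prop :=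
  forall x y : S,
    (forall lam, functionals R S lam ->
       rank x lam + r%:E * rank w lam <= rank y lam) ->
    (x <= y)%O.

Definition radius_comparison (R : realType) (d : Order.disp_t)
    (S : cuSemigroupType d) (w : S) : \bar R :=
  ereal_inf (EFin @` [set r : R | (0 < r)%R /\ has_comparison r w]).
Arguments radius_comparison R {d S} w.

(* Main.v *)
Require Import Defs.
From mathcomp Require Import all_boot all_order all_algebra.
From mathcomp Require Import all_classical all_reals all_analysis.

(** If [rank w <= s * rank w'], then [r]-comparison relative to [w] gives
    [s * r]-comparison relative to [w'], so
    [rc w' <= rho w w' * rc w] whenever [0 < rho w w' < +oo]. Apply this to
    [(y, y_n)] and to [(y_n, y)] and pass to the limit. A functional [lam] with
    [lam y = 1] gives [rho y y_n >= 1], and [lam y_n > 0] as soon as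
    [rho y y_n] is finite, whence [rho y_n y >= lam y_n > 0]: no product
    [0 * +oo] arises in the limit. *)

Import Order.TTheory GRing.Theory Num.Theory.

Local Open Scope classical_set_scope.
Local Open Scope ereal_scope.

Lemma le_ereal_infM (R : realType) (A B : set R) (c : \bar R) :
  0 < ereal_inf (EFin @` A) < +oo ->
  (forall b, B b -> 0 < b)%R ->
  (forall a b, A a -> B b -> c <= (a * b)%:E) ->
  c <= ereal_inf (EFin @` A) * ereal_inf (EFin @` B).
Proof.
case aE: (ereal_inf (EFin @` A)) => [a0||] /andP[a0_gt0 a0_lty] // B_gt0 cAB.
rewrite -lee_pdivrMl//; apply: le_ereal_inf_tmp => _ [b Bb <-].
rewrite lee_pdivrMl// -lee_pdivrMr ?B_gt0// -aE.
apply: le_ereal_inf_tmp => _ [a Aa <-].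
by rewrite lee_pdivrMr ?B_gt0// -EFinM cAB.
Qed.

Section CuComparison.
Set Implicit Arguments.
Unset Strict Implicit.

Variables (R : realType) (d : Order.disp_t) (S : cuSemigroupType d).
Implicit Types (x y z w : S) (lam : S -> \bar R).

Local Notation rho := (rank_ratio R).
Local Notation rc := (radius_comparison R).

Lemma rank_ratio_le_l x x' y : (x <= x')%O -> rho x y <= rho x' y.
Proof.
move=> xx'; apply/ereal_inf_le_tmp/image_subset => r [r_gt0 rP].
split=> // lam Flam; apply: le_trans (rP lam Flam).
exact: functional_homo Flam _ _ xx'.
Qed.

Lemma rank_ratio_le_r x y y' : (y <= y')%O -> rho x y' <= rho x y.
Proof.
move=> yy'; apply/ereal_inf_le_tmp/image_subset => r [r_gt0 rP].
split=> // lam Flam; apply: le_trans (rP lam Flam) _.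
by rewrite lee_pmul2l ?lte_fin//; exact: functional_homo Flam _ _ yy'.
Qed.

Lemma rank_ratio_le1 x y : (x <= y)%O -> rho x y <= 1.
Proof.
move=> xy; apply: ereal_inf_lbound; exists 1%R => //; split=> // lam Flam.
by rewrite mul1e; exact: functional_homo Flam _ _ xy.
Qed.

Lemma le_rank_ratio lam x y :
  functionals_at R y lam -> lam x <= rho x y.
Proof.
move=> [Flam lam1]; apply: le_ereal_inf_tmp => _ [r [_ rP] <-].
by have := rP lam Flam; rewrite /rank lam1 mule1.
Qed.

(** If [lam x = 0], any real [r] bounding the ratio would give [1 = lam y <= r * 0]. *)
Lemma functional_gt0 lam x y :
  functionals_at R y lam -> rho y x < +oo -> 0 < lam x.
Proof.
move=> [Flam lam1] /ereal_inf_ltP[_ [r [_ rP] <-] _].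
rewrite lt_neqAle functional_ge0// andbT; apply/eqP => lamx.
by have := rP lam Flam; rewrite /rank lam1 -lamx mule0 lee_fin ler10.
Qed.

Lemma radius_comparison_le w w' : (w <= w')%O -> rc w' <= rc w.
Proof.
move=> ww'; apply/ereal_inf_le_tmp/image_subset => r [r_gt0 rP].
split=> // x z xz; apply: rP => lam Flam; apply: le_trans (xz lam Flam).
by rewrite leeD2l// lee_pmul2l ?lte_fin//; exact: functional_homo Flam _ _ ww'.
Qed.

Lemma radius_comparison_ge0 w : 0 <= rc w.
Proof.
by apply: le_ereal_inf_tmp => _ [r [r_gt0 _] <-]; rewrite lee_fin ltW.
Qed.

Lemma radius_comparison_le_rank_ratio w w' :
  0 < rho w w' < +oo -> rc w' <= rho w w' * rc w.
Proof.
(* It suffices to bound [rc w'] by [s * r] for every admissible ratio [s] and every comparison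
   radius [r] of [w]. *)
move=> rho_fin; apply: le_ereal_infM => // [r []//|s r [s_gt0 sP] [r_gt0 rP]].
apply: ereal_inf_lbound; exists (s * r)%R => //; split; first exact: mulr_gt0.
move=> x z xz; apply: rP => lam Flam; apply: le_trans (xz lam Flam).
rewrite leeD2l// mulrC EFinM -muleA lee_pmul2l ?lte_fin//.
exact: sP.
Qed.

End CuComparison.

Theorem theorem5p4 (R : realType) (d : Order.disp_t) (S : cuSemigroupType d)
    (y : S) (y_ : nat -> S)
    (y_full : Full S y) (yn_full : forall n, Full S (y_ n))
    (yn_le : forall n, (y_ n <= y_ n.+1 <= y)%O)
    (Fy_neq0 : functionals_at R y !=set0)
    (lim_rho_fin : limn (fun n => rank_ratio R y (y_ n)) < +oo) :
  (limn (fun n => rank_ratio R (y_ n) y))^-1 * radius_comparison R y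
    <= limn (fun n => radius_comparison R (y_ n))
  /\
  limn (fun n => radius_comparison R (y_ n))
    <= limn (fun n => rank_ratio R y (y_ n)) * radius_comparison R y.
Proof.
have [lam Hlam] := Fy_neq0.
have y_nd : {homo y_ : n m / (n <= m)%N >-> (n <= m)%O}.
  by apply/nondecreasing_seqP => n; case/andP: (yn_le n).
have y_le n : (y_ n <= y)%O.
  by case/andP: (yn_le n) => /le_trans; apply.
have rho1_ni : {homo (fun n => rank_ratio R y (y_ n)) :
    n m / (n <= m)%N >-> m <= n}.
  by move=> n m nm; apply/rank_ratio_le_r/y_nd.
have rho2_nd : {homo (fun n => rank_ratio R (y_ n) y) :
    n m / (n <= m)%N >-> n <= m}.
  by move=> n m nm; apply/rank_ratio_le_l/y_nd.
have rc_ni : {homo (fun n => radius_comparison R (y_ n)) :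
    n m / (n <= m)%N >-> m <= n}.
  by move=> n m nm; apply/radius_comparison_le/y_nd.
have rho1_cvg := ereal_nonincreasing_is_cvgn rho1_ni.
have rho2_cvg := ereal_nondecreasing_is_cvgn rho2_nd.
have rc_cvg := ereal_nonincreasing_is_cvgn rc_ni.
have rho1_ge1 n : 1 <= rank_ratio R y (y_ n).
  (* With [1] written as [lam y], the chain is [lam y <= rho y y <= rho y (y_ n)]. *)
  case: (Hlam) => _ <-.
  exact: le_trans (le_rank_ratio y Hlam) (rank_ratio_le_r _ y (y_le n)).
(* The limit of a nonincreasing sequence is its infimum, so a finite limit forces a finite term.
   Terms before [N] may be [+oo]; the estimates below are made from [N] on. *)
have [N rhoN] : exists N, rank_ratio R y (y_ N) < +oo.
  move: lim_rho_fin; rewrite (cvg_lim _ (ereal_nonincreasing_cvgn rho1_ni))//.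
  by move=> /ereal_inf_ltP[_ [N _ <-] ?]; exists N.
have rho1_fin n : (N <= n)%N -> rank_ratio R y (y_ n) < +oo.
  by move=> /rho1_ni /le_lt_trans; apply.
have rho2_gt0 n : (N <= n)%N -> 0 < rank_ratio R (y_ n) y.
  by move=> /rho1_fin /(functional_gt0 Hlam) /lt_le_trans; apply;
    exact: le_rank_ratio.
have rc_le1 n : (N <= n)%N -> radius_comparison R (y_ n) <=
    rank_ratio R y (y_ n) * radius_comparison R y.
  move=> Nn; apply: radius_comparison_le_rank_ratio.
  by rewrite rho1_fin// (lt_le_trans _ (rho1_ge1 n)).
have rc_le2 n : (N <= n)%N -> radius_comparison R y <=
    rank_ratio R (y_ n) y * radius_comparison R (y_ n).
  move=> Nn; apply: radius_comparison_le_rank_ratio.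
  by rewrite rho2_gt0// (le_lt_trans (rank_ratio_le1 _ (y_le n))) ?ltry.
have lim1_ge1 : 1 <= limn (fun n => rank_ratio R y (y_ n)).
  by apply: lime_ge => //; exact: nearW.
split.
- have lim2_gt0 : 0 < limn (fun n => rank_ratio R (y_ n) y).
    rewrite (cvg_lim _ (ereal_nondecreasing_cvgn rho2_nd))//.
    by apply: lt_le_trans (rho2_gt0 N _) (ereal_sup_ubound _) => //; exists N.
  have lim2_le1 : limn (fun n => rank_ratio R (y_ n) y) <= 1.
    by apply: lime_le => //; apply: nearW => n; exact: rank_ratio_le1.
  (* The limit of the ratios is kept fixed and dominates each term as their supremum, so only
     [rc (y_ n)] passes to the limit. *)
  apply: lime_ge => //; near=> n.
  have Nn : (N <= n)%N by near: n; exact: nbhs_infty_ge.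
  have lim2_ub : rank_ratio R (y_ n) y <= limn (fun n => rank_ratio R (y_ n) y).
    rewrite (cvg_lim _ (ereal_nondecreasing_cvgn rho2_nd))//.
    by apply: ereal_sup_ubound; exists n.
  (* The limit lies in [(0, 1]], hence is a real [s] whose inverse is the usual one. *)
  move: lim2_gt0 lim2_le1 lim2_ub; case: (limn _) => [s||] //.
  rewrite lte_fin => s_gt0 _ lim2_ub.
  rewrite inver gt_eqF// lee_pdivrMl//; apply: le_trans (rc_le2 n Nn) _.
  by rewrite lee_wpmul2r// radius_comparison_ge0.
- have rho_rc_cvg : (fun n => rank_ratio R y (y_ n) * radius_comparison R y)
      @ \oo --> limn (fun n => rank_ratio R y (y_ n)) * radius_comparison R y.
    apply: cvgeM => //; last exact: cvg_cst.
    have lim1_fin : limn (fun n => rank_ratio R y (y_ n)) \is a fin_num.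
      by rewrite ge0_fin_numE// (le_trans _ lim1_ge1).
    (* Continuity of the product requires its limit to avoid [0 * +oo]: either both factors are
       finite, or [rc y] is infinite and the other factor is at least [1]. *)
    have [rc_fin|rc_inf] := boolP (radius_comparison R y \is a fin_num).
      exact: mule_def_fin.
    by apply: mule_def_neq0_infty => //; rewrite gt_eqF// (lt_le_trans _ lim1_ge1).
  rewrite -(cvg_lim _ rho_rc_cvg)//; apply: lee_lim => //.
    by apply/cvg_ex; eexists; exact: rho_rc_cvg.
  by near=> n; apply: rc_le1; near: n; exact: nbhs_infty_ge.
Unshelve. all: by end_near.
Qed.
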